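(* (a) Let $d\in\mathbb{S}$ be a type A distance. There exists a set $\mathcal{P}\subset\mathbb{S}^2$ of size $n$ such that the number of pairs in $\mathcal{P}^2$ that span $d$ is $\Theta(n^2)$. (b) Assuming that the unit distance bound $O(m^{2/3}n^{2/3}+m+n)$ (the bound for incidences between $m$ points and $n$ unit circles in $\mathbb{R}^2$) is sharp when $m=n^{1-\lambda}$, the upper bound $O\big((n^{4/3+\lambda/3}+n^{1+\lambda})\log^2 n\big)$ on the number of times a type A distance is spanned by a set of points in $\mathbb{S}^2$ is also sharp for sets of size $n$ and minimal multiplicity $n^{\lambda}$, up to polylogarithmic factors. (c) Assuming that the unit distance bound $O(m^{2/3}n^{2/3}+m+n)$ is sharp when $m=n$, the upper bound $O(n^{1+\lambda/3})$ on the number of times a type B (respectively, type C) distance is spanned by a set of points in $\mathbb{S}^2$ is also sharp for sets of size $n$ and real (respectively, imaginary) multiplicity $n^{\lambda}$.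
   Context: The double numbers $\mathbb{S}$ are the two-dimensional unital associative $\mathbb{R}$-algebra obtained by adjoining to $\mathbb{R}$ an element $j$ with $j^2=1$. Each double number is uniquely $X+Yj$ with $X,Y\in\mathbb{R}$; it is denoted $\langle x,y\rangle$ where $x=X+Y$ and $y=X-Y$. A point $(X+Yj,Z+Wj)\in\mathbb{S}^2$ is denoted $\langle x,y,z,w\rangle$ where $x=X+Y$, $y=X-Y$, $z=Z+W$, $w=Z-W$. Its real part is $(x,z)\in\mathbb{R}^2$ and its imaginary part is $(y,w)\in\mathbb{R}^2$. The distance function $\rho_{\mathbb{S}^2}:\mathbb{S}^2\times\mathbb{S}^2\to\mathbb{S}$ is $\rho_{\mathbb{S}^2}((a,b),(a',b'))=(a-a')^2+(b-b')^2$ (arithmetic in $\mathbb{S}$). In the new coordinates, \[\rho_{\mathbb{S}^2}(\langle x,y,z,w\rangle,\langle x',y',z',w'\rangle)=\langle (x-x')^2+(z-z')^2,\ (y-y')^2+(w-w')^2\rangle .\] A pair $(p,q)$ spans $d$ if $\rho_{\mathbb{S}^2}(p,q)=d$; the number of times a set spans $d$ is the number of pairs of its points spanning $d$. Distances are elements $d=\langle d_1,d_2\rangle$ with $d_1,d_2\ge 0$. A non-zero distance is of type A if $d_1>0$ and $d_2>0$; of type B if $d_1=0$ and $d_2>0$; of type C if $d_1>0$ and $d_2=0$. For a finite nonempty set $\mathcal{P}\subset\mathbb{S}^2$, the real (respectively, imaginary) multiplicity is the largest integer $k$ such that $k$ points of $\mathcal{P}$ have the same real (respectively, imaginary) part;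 the minimal multiplicity is the minimum of the real and imaginary multiplicities. Here $0\le\lambda\le 1$. The upper bounds whose sharpness is discussed are known: a set of $n$ points in $\mathbb{S}^2$ spans a type A distance $O\big((n^{4/3+\lambda/3}+n^{1+\lambda})\log^2 n\big)$ times if its minimal multiplicity is $n^\lambda$, spans a type B distance $O(n^{1+\lambda/3})$ times if its real multiplicity is $n^\lambda$, and spans a type C distance $O(n^{1+\lambda/3})$ times if its imaginary multiplicity is $n^\lambda$. The unit distance bound referred to is the known theorem that the number of incidences (point–circle pairs with the point on the circle) between a set of $m$ points and a set of $n$ unit circles in $\mathbb{R}^2$ is $O(m^{2/3}n^{2/3}+m+n)$. ''Sharp'' means asymptotically attained, i.e., the bound cannot be improved in order of magnitude. *)

(* Defs.v *)
From HB Require Import structures.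
From mathcomp Require Import all_boot all_order all_algebra.
From mathcomp Require Import finmap.
From mathcomp Require Import all_classical all_reals all_analysis.
From mathcomp Require Import ring.
Import Order.TTheory GRing.Theory Num.Theory.
Set Implicit Arguments.
Unset Strict Implicit.
Unset Printing Implicit Defensive.

Local Open Scope classical_set_scope.
Local Open Scope ring_scope.

(* The pair (X, Y) stands for the double number X + Y j, where j ^+ 2 = 1.
   The alias is needed because R * R itself carries the componentwise
   product. *)
Definition dblnum (R : Type) : Type := (R * R)%type.

HB.instance Definition _ (R : realType) :=
  GRing.Lmodule.copy (dblnum R) (R^o * R^o)%type.

Definition dblnum_one (R : realType) : dblnum R := (1, 0).

Definition dblnum_mul (R : realType) (s t : dblnum R) : dblnum R :=
  (s.1 * t.1 + s.2 * t.2, s.1 * t.2 + s.2 * t.1).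

Lemma dblnum_mulA (R : realType) : associative (@dblnum_mul R).
Proof. by move=> [a b] [c d] [e f]; congr pair => /=; ring. Qed.

Lemma dblnum_mulC (R : realType) : commutative (@dblnum_mul R).
Proof. by move=> [a b] [c d]; congr pair => /=; ring. Qed.

Lemma dblnum_mul1 (R : realType) : left_id (dblnum_one R) (@dblnum_mul R).
Proof. by move=> [a b]; congr pair => /=; ring. Qed.

Lemma dblnum_mulDl (R : realType) : left_distributive (@dblnum_mul R) +%R.
Proof. by move=> [a b] [c d] [e f]; congr pair => /=; ring. Qed.

Lemma dblnum_one_neq0 (R : realType) : dblnum_one R != 0.
Proof. by apply/eqP => -[/eqP]; rewrite oner_eq0. Qed.

HB.instance Definition _ (R : realType) :=
  GRing.Zmodule_isComNzRing.Build (dblnum R) (@dblnum_mulA R) (@dblnum_mulC R)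
    (@dblnum_mul1 R) (@dblnum_mulDl R) (@dblnum_one_neq0 R).

Lemma dblnum_scaleAl (R : realType) (a : R) (s t : dblnum R) :
  a *: (s * t) = (a *: s) * t.
Proof.
case: s t => [b c] [d e].
by congr pair; rewrite /= /GRing.scale /= /GRing.scale /=; ring.
Qed.

HB.instance Definition _ (R : realType) :=
  GRing.Lmodule_isLalgebra.Build R (dblnum R) (@dblnum_scaleAl R).

HB.instance Definition _ (R : realType) :=
  GRing.Lalgebra_isComAlgebra.Build R (dblnum R).

Definition dblnum_j (R : realType) : dblnum R := (0, 1).

Lemma dblnum_j_sqr (R : realType) : dblnum_j R ^+ 2 = 1.
Proof. by rewrite expr2; congr pair => /=; ring. Qed.

Lemma dblnumE (R : realType) (s : dblnum R) : s = s.1%:A + s.2 *: dblnum_j R.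
Proof.
by case: s => X Y; congr pair; rewrite /= /GRing.scale /= /GRing.scale /=; ring.
Qed.

(* The coordinates x and y of X + Y j = <x, y>. *)
Definition re_coord (R : realType) (s : dblnum R) : R := s.1 + s.2.
Definition im_coord (R : realType) (s : dblnum R) : R := s.1 - s.2.

(* With p = <x, y, z, w>, these are (x, z) and (y, w). *)
Definition real_part (R : realType) (p : dblnum R * dblnum R) : R * R :=
  (re_coord p.1, re_coord p.2).
Definition imag_part (R : realType) (p : dblnum R * dblnum R) : R * R :=
  (im_coord p.1, im_coord p.2).

Definition rho (R : realType) (p q : dblnum R * dblnum R) : dblnum R :=
  (p.1 - q.1) ^+ 2 + (p.2 - q.2) ^+ 2.

Definition sqdist (R : realType) (u v : R * R) : R :=
  (u.1 - v.1) ^+ 2 + (u.2 - v.2) ^+ 2.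

Lemma re_coordB (R : realType) (s t : dblnum R) :
  re_coord (s - t) = re_coord s - re_coord t.
Proof. by rewrite /re_coord /=; ring. Qed.

Lemma im_coordB (R : realType) (s t : dblnum R) :
  im_coord (s - t) = im_coord s - im_coord t.
Proof. by rewrite /im_coord /=; ring. Qed.

Lemma re_coordD (R : realType) (s t : dblnum R) :
  re_coord (s + t) = re_coord s + re_coord t.
Proof. by rewrite /re_coord /=; ring. Qed.

Lemma im_coordD (R : realType) (s t : dblnum R) :
  im_coord (s + t) = im_coord s + im_coord t.
Proof. by rewrite /im_coord /=; ring. Qed.

Lemma re_coordM (R : realType) (s t : dblnum R) :
  re_coord (s * t) = re_coord s * re_coord t.
Proof. by rewrite /re_coord /=; ring. Qed.

Lemma im_coordM (R : realType) (s t : dblnum R) :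
  im_coord (s * t) = im_coord s * im_coord t.
Proof. by rewrite /im_coord /=; ring. Qed.

Lemma re_coord_rho (R : realType) (p q : dblnum R * dblnum R) :
  re_coord (rho p q) = sqdist (real_part p) (real_part q).
Proof. by rewrite /rho /sqdist !expr2 re_coordD !re_coordM !re_coordB. Qed.

Lemma im_coord_rho (R : realType) (p q : dblnum R * dblnum R) :
  im_coord (rho p q) = sqdist (imag_part p) (imag_part q).
Proof. by rewrite /rho /sqdist !expr2 im_coordD !im_coordM !im_coordB. Qed.

Definition typeA (R : realType) (d : dblnum R) : Prop :=
  0 < re_coord d /\ 0 < im_coord d.
Definition typeB (R : realType) (d : dblnum R) : Prop :=
  re_coord d = 0 /\ 0 < im_coord d.
Definition typeC (R : realType) (d : dblnum R) : Prop :=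
  0 < re_coord d /\ im_coord d = 0.

(* Ordered pairs are counted; for d != 0 this is twice the number of unordered
   ones. *)
Definition num_spans (R : realType) (P : {fset dblnum R * dblnum R})
    (d : dblnum R) : nat :=
  #|` [fset e in (P `*` P)%fset | rho e.1 e.2 == d]%fset |.

Definition multiplicity (T U : choiceType) (f : T -> U) (P : {fset T}) : nat :=
  \max_(p <- P) #|` [fset q in P | f q == f p]%fset |.

Definition real_mult (R : realType) (P : {fset dblnum R * dblnum R}) : nat :=
  multiplicity (@real_part R) P.
Definition imag_mult (R : realType) (P : {fset dblnum R * dblnum R}) : nat :=
  multiplicity (@imag_part R) P.
Definition min_mult (R : realType) (P : {fset dblnum R * dblnum R}) : nat :=
  minn (real_mult P) (imag_mult P).

Definition unit_circle (R : realType) (c : R * R) : set (R * R) :=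
  [set u | sqdist u c = 1].

(* A finite set of unit circles is given by the set C of their centers. *)
Definition incidences (R : realType) (A C : {fset R * R}) : nat :=
  #|` [fset e in (A `*` C)%fset | e.1 \in unit_circle e.2]%fset |.

Definition unit_distance_bound (R : realType) (m n : nat) : R :=
  m%:R `^ (2 / 3) * n%:R `^ (2 / 3) + m%:R + n%:R.

Definition unit_distance_bound_sharp (R : realType) (m : nat -> nat) : Prop :=
  exists2 c : R, 0 < c &
    \forall n \near \oo, exists A C : {fset R * R},
      [/\ #|` A| = m n, #|` C| = n
        & c * unit_distance_bound R (m n) n <= (incidences A C)%:R].

(* Since n ^ lam is in general not an integer, a multiplicity n ^ lam is read
   as Theta(n ^ lam). An exact rounding would not do at the endpoints: for
   n > 1 no set of n points has minimal multiplicity n, and a set of real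
   multiplicity 1 spans no type B distance. The constants do not depend on the
   distance d. *)
Definition span_bound_sharp (R : realType) (is_type : dblnum R -> Prop)
    (mult : {fset dblnum R * dblnum R} -> nat) (lam : R)
    (bound : nat -> R) : Prop :=
  exists c1 c2 c : R, [/\ 0 < c1, 0 < c2, 0 < c &
    \forall n \near \oo, forall d, is_type d ->
      exists P : {fset dblnum R * dblnum R},
        [/\ #|` P| = n,
            c1 * n%:R `^ lam <= (mult P)%:R <= c2 * n%:R `^ lam
          & c * bound n <= (num_spans P d)%:R]].

(* Sharpness of the bound up to a factor (ln n) ^ k for some fixed k. *)
Definition span_bound_sharp_polylog (R : realType) (is_type : dblnum R -> Prop)
    (mult : {fset dblnum R * dblnum R} -> nat) (lam : R)
    (bound : nat -> R) : Prop :=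
  exists k : nat,
    span_bound_sharp is_type mult lam (fun n => bound n / ln n%:R ^+ k).

Definition typeA_bound (R : realType) (lam : R) (n : nat) : R :=
  (n%:R `^ (4 / 3 + lam / 3) + n%:R `^ (1 + lam)) * ln n%:R ^+ 2.

Definition typeBC_bound (R : realType) (lam : R) (n : nat) : R :=
  n%:R `^ (1 + lam / 3).

(* Main.v *)
Require Import Defs.
From mathcomp Require Import all_boot all_order all_algebra.
From mathcomp Require Import finmap.
From mathcomp Require Import all_classical all_reals all_analysis.
From mathcomp Require Import ring lra zify.
Import Order.TTheory GRing.Theory Num.Theory.
Local Open Scope classical_set_scope.
Local Open Scope ring_scope.

(** Seen through its real and imaginary parts, a point of the double plane is a
    pair of points of R^2, and spanning d means that the two real parts are at
    squared distance d1 and the two imaginary parts at squared distance d2.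

    Type A: given points A and circle centers C in R^2, put k points on a circle
    of squared radius d2 over each point of A, and the center of that circle
    over each point of C.  Every incidence of (A, C), scaled by sqrt d1, then
    gives k pairs spanning d.  With A = {0} and C on the unit circle this is
    (a); with |A| about n^(1 - lam), k about n^lam and a set C of size about n
    it is (b).

    Type B: above each of g distinct real parts put a copy of A and C, scaled by
    sqrt d2; every incidence gives g pairs spanning d.  For (c) the sizes of A
    and C are of order n^lam and g is of order n^(1 - lam).  Type C follows by
    the conjugation X + Y j |-> X - Y j, which exchanges real and imaginary
    parts. *)

(** * Cardinalities of finite sets and multiplicities of maps *)

Lemma leq_card_fset_inj {T U : choiceType} (f : T -> U)
    (E : {fset T}) (F : {fset U}) :
  {in E &, injective f} -> (forall x, x \in E -> f x \in F) ->
  (#|` E| <= #|` F|)%N.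
Proof.
move=> finj fEF; rewrite -(card_in_imfset imfset_key finj).
by apply/fsubset_leq_card/fsubsetP => _ /imfsetP[x xE ->]; exact: fEF.
Qed.

Lemma card_fset_iota (k : nat) : #|` [fset i in iota 0 k]%fset| = k.
Proof. by rewrite card_fseq undup_id ?iota_uniq// size_iota. Qed.

Lemma cardfsM {T U : choiceType} (A : {fset T}) (B : {fset U}) :
  #|` (A `*` B)%fset| = (#|` A| * #|` B|)%N.
Proof.
have -> : (A `*` B = [fset e in [seq (x, y) | x <- A, y <- B]])%fset.
  apply/fsetP => -[x y]; rewrite in_fsetM in_fset/=.
  apply/andP/allpairsP => [[xA yB]|[[x' y'] /= [xA yB [-> ->]]]//].
  by exists (x, y).
rewrite card_fseq undup_id ?size_allpairs//.
by apply: allpairs_uniq => // -[x y] [x' y'] _ _ /= [-> ->].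
Qed.

Lemma in_fset_sep {T : choiceType} (A : {fset T}) (p : pred T) (x : T) :
  (x \in [fset y in A | p y]%fset) = (x \in A) && p x.
Proof. by rewrite !inE. Qed.

Lemma multiplicity_ge {T U : choiceType} (f : T -> U) (P : {fset T}) (u : U) :
  (#|` [fset q in P | f q == u]%fset| <= multiplicity f P)%N.
Proof.
have [->|[p]] := fset_0Vmem [fset q in P | f q == u]%fset.
  by rewrite cardfs0.
rewrite !inE => /andP[pP /eqP <-].
exact: (leq_bigmax_seq (F := fun p => #|` [fset q in P | f q == f p]%fset|)).
Qed.

Lemma multiplicity_le {T U : choiceType} (f : T -> U) (P : {fset T}) (m : nat) :
  (forall u, #|` [fset q in P | f q == u]%fset| <= m)%N ->
  (multiplicity f P <= m)%N.
Proof. by move=> le_m; apply/bigmax_leqP_seq => p _ _; exact: le_m. Qed.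

Lemma multiplicity_subset {T U : choiceType} (f : T -> U) (P Q : {fset T}) :
  (P `<=` Q)%fset -> (multiplicity f P <= multiplicity f Q)%N.
Proof.
move=> /fsubsetP PQ; apply: multiplicity_le => u.
apply: leq_trans (multiplicity_ge f Q u); apply/fsubset_leq_card/fsubsetP => q.
by rewrite !inE => /andP[/PQ -> ->].
Qed.

(** The fibers of [f] in the image of [P] are the images under [h] of the fibers of [f \o h] in [P],
    and [h] preserves their sizes. *)
Lemma multiplicity_imfset {T U V : choiceType} (f : T -> U) (h : V -> T)
    (P : {fset V}) : injective h ->
  multiplicity f (h @` P)%fset = multiplicity (f \o h) P.
Proof.
move=> hinj; have fiberE u : [fset q in h @` P | f q == u]%fset =
    (h @` [fset q in P | (f \o h) q == u])%fset.
  apply/fsetP => q; rewrite !inE; apply/andP/imfsetP.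
    move=> [/imfsetP[p /= pP ->] fpu]; exists p => //=.
    by rewrite !inE/= pP.
  move=> [p]; rewrite !inE => /andP[/= pP fpu] ->; split=> //.
  by apply/imfsetP; exists p.
apply/eqP; rewrite eqn_leq; apply/andP; split; apply: multiplicity_le => u.
  by rewrite fiberE card_imfset//= multiplicity_ge.
apply: leq_trans (multiplicity_ge f (h @` P)%fset u); rewrite fiberE.
by apply: (leq_card_fset_inj h) => [p q _ _ /hinj//|p pu]; exact: in_imfset.
Qed.

(** * Coordinates, conjugation and padding in the double plane *)

Section DoublePlane.
Context {R : realType}.
Implicit Types (u v : R * R) (p q : dblnum R * dblnum R) (d : dblnum R).

(** Inverts x = X + Y, y = X - Y in both entries, so that [u] becomes the real part and [v] the
    imaginary part. *)
Definition dblpt u v : dblnum R * dblnum R :=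
  (((u.1 + v.1) / 2, (u.1 - v.1) / 2), ((u.2 + v.2) / 2, (u.2 - v.2) / 2)).

Lemma real_part_dblpt u v : real_part (dblpt u v) = u.
Proof.
by case: u v => a b [x y]; rewrite /real_part /re_coord/=; congr pair; field.
Qed.

Lemma imag_part_dblpt u v : imag_part (dblpt u v) = v.
Proof.
by case: u v => a b [x y]; rewrite /imag_part /im_coord/=; congr pair; field.
Qed.

Lemma eq_dblpt u v u' v' : dblpt u v = dblpt u' v' -> u = u' /\ v = v'.
Proof.
move=> e; split.
  by rewrite -(real_part_dblpt u v) e real_part_dblpt.
by rewrite -(imag_part_dblpt u v) e imag_part_dblpt.
Qed.

Lemma rho_dblpt u v u' v' d :
  sqdist u u' = re_coord d -> sqdist v v' = im_coord d ->
  rho (dblpt u v) (dblpt u' v') = d.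
Proof.
move=> ud vd; have re : re_coord (rho (dblpt u v) (dblpt u' v')) = re_coord d.
  by rewrite re_coord_rho !real_part_dblpt.
have im : im_coord (rho (dblpt u v) (dblpt u' v')) = im_coord d.
  by rewrite im_coord_rho !imag_part_dblpt.
case: (rho _ _) d re im {ud vd} => a b [a' b'].
rewrite /re_coord /im_coord/= => re im; congr pair; lra.
Qed.

Lemma num_spans_subset (P Q : {fset dblnum R * dblnum R}) d :
  (P `<=` Q)%fset -> (num_spans P d <= num_spans Q d)%N.
Proof.
move=> /fsubsetP PQ; apply/fsubset_leq_card/fsubsetP => e.
by rewrite !inE => /andP[/andP[/PQ -> /PQ ->] ->].
Qed.

Lemma num_spans_le (P : {fset dblnum R * dblnum R}) d :
  (num_spans P d <= #|` P| * #|` P|)%N.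
Proof.
rewrite -cardfsM; apply/fsubset_leq_card/fsubsetP => e.
by rewrite !inE => /andP[].
Qed.

Definition dblconj d : dblnum R := (d.1, - d.2).
Definition ptconj p := (dblconj p.1, dblconj p.2).

Lemma dblconjK : involutive dblconj.
Proof. by case=> a b; rewrite /dblconj/= opprK. Qed.

Lemma ptconjK : involutive ptconj.
Proof. by case=> a b; rewrite /ptconj/= !dblconjK. Qed.

Lemma re_coord_conj d : re_coord (dblconj d) = im_coord d.
Proof. by []. Qed.

Lemma im_coord_conj d : im_coord (dblconj d) = re_coord d.
Proof. by rewrite /im_coord/= opprK. Qed.

Lemma imag_part_conj p : imag_part (ptconj p) = real_part p.
Proof. by rewrite /imag_part !im_coord_conj. Qed.

Lemma rho_conj p q : rho (ptconj p) (ptconj q) = dblconj (rho p q).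
Proof.
case: p q => [[a b] [x y]] [[a' b'] [x' y']].
by rewrite /rho !expr2; congr pair; rewrite /=; ring.
Qed.

Lemma imag_mult_conj (P : {fset dblnum R * dblnum R}) :
  imag_mult (ptconj @` P)%fset = real_mult P.
Proof.
rewrite /imag_mult multiplicity_imfset; last exact: inv_inj ptconjK.
by congr (multiplicity _ P); apply/funext => p; exact: imag_part_conj.
Qed.

Lemma num_spans_conj (P : {fset dblnum R * dblnum R}) d :
  (num_spans P (dblconj d) <= num_spans (ptconj @` P)%fset d)%N.
Proof.
apply: (leq_card_fset_inj (fun e => (ptconj e.1, ptconj e.2))).
  move=> [a b] [a' b'] _ _ e; congr pair; apply: (inv_inj ptconjK).
    exact: (congr1 fst e).
  exact: (congr1 snd e).
move=> [a b]; rewrite !inE/= => /andP[/andP[aP bP] /eqP ab].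
by rewrite rho_conj ab dblconjK eqxx !in_imfset.
Qed.

(** The conjugate of a type C distance has type B. Conjugating the set obtained for it turns real
    into imaginary multiplicity, with the same three constants. *)
Lemma span_bound_sharp_conj (lam : R) (bound : nat -> R) :
  span_bound_sharp (@typeB R) (@real_mult R) lam bound ->
  span_bound_sharp (@typeC R) (@imag_mult R) lam bound.
Proof.
move=> [c1 [c2 [c [c1_gt0 c2_gt0 c_gt0 sharp]]]]; exists c1, c2, c; split=> //.
apply: filterS sharp => n sharp d [d1 d2].
have [|P [cardP multP spanP]] := sharp (dblconj d).
  by split; rewrite ?re_coord_conj ?im_coord_conj.
exists (ptconj @` P)%fset; split.
- by rewrite card_imfset//=; exact: inv_inj ptconjK.
- by rewrite imag_mult_conj.
- by rewrite (le_trans spanP)// ler_nat num_spans_conj.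
Qed.

Lemma exists_fresh_point (F : {fset R * R}) : exists u, u \notin F.
Proof.
have [N hN] : exists N : R, forall u, u \in F -> u.1 < N.
  (* The sum of the absolute values bounds each first coordinate; adding 1 makes the bound
     strict. *)
  exists (\sum_(u <- F) `|u.1| + 1) => u uF.
  rewrite (big_fsetD1 u)//= (le_lt_trans (ler_norm _))//.
  by rewrite -addrA ltrDl ltr_wpDl// sumr_ge0.
by exists (N, 0); apply/negP => /hN/=; rewrite ltxx.
Qed.

(** The constructions below give sets of at most n points. Adding points with pairwise distinct
    fresh real parts reaches size exactly n, keeps all spanning pairs, and creates only new fibers
    of size 1. *)
Lemma pad_real_mult (Q : {fset dblnum R * dblnum R}) (n : nat) :
  (#|` Q| <= n)%N ->
  exists P, [/\ (Q `<=` P)%fset, #|` P| = n &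
    (real_mult P <= maxn 1 (real_mult Q))%N].
Proof.
elim: n => [|n IH] Qn.
  exists Q; split=> //; first by apply/eqP; rewrite -leqn0.
  by rewrite leq_max leqnn orbT.
move: Qn; rewrite leq_eqVlt => /orP[/eqP <-|].
  by exists Q; split=> //; rewrite leq_max leqnn orbT.
rewrite ltnS => /IH[P [QP Pn multP]].
have [u uP] := exists_fresh_point (@real_part R @` P)%fset.
have fresh q : q \in P -> real_part q != u.
  by move=> qP; apply: contraNneq uP => <-; rewrite in_imfset.
exists (dblpt u 0 |` P)%fset; split.
- exact: fsubset_trans QP (fsubsetU1 _ _).
- rewrite cardfsU1 Pn; case: (boolP (_ \in P)) => //= /fresh.
  by rewrite real_part_dblpt eqxx.
apply: multiplicity_le => v; have [->|vu] := eqVneq v u.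
  rewrite leq_max -(cardfs1 (dblpt u 0)); apply/orP; left.
  apply/fsubset_leq_card/fsubsetP => q; rewrite !inE => /andP[/orP[//|]].
  by move=> /fresh/negPf ->.
apply: leq_trans multP; apply: leq_trans (multiplicity_ge _ P v).
apply/fsubset_leq_card/fsubsetP => q; rewrite !inE.
move=> /andP[/orP[/eqP->|->->//]].
by rewrite real_part_dblpt eq_sym (negPf vu).
Qed.

(** * The point sets for types A and B *)

Lemma sqdistC u v : sqdist u v = sqdist v u.
Proof. by rewrite /sqdist; ring. Qed.

Lemma sqdist_scale (s : R) u v : sqdist (s *: u) (s *: v) = s ^+ 2 * sqdist u v.
Proof. by rewrite /sqdist /= /GRing.scale/=; ring. Qed.

(** The rational parametrization of the unit circle by slopes through (-1, 0); natural slopes supply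
    as many distinct points as desired. *)
Definition circle_point (t : nat) : R * R :=
  ((1 - t%:R ^+ 2) / (1 + t%:R ^+ 2), t%:R *+ 2 / (1 + t%:R ^+ 2)).

Lemma sqdist_circle_point0 t : sqdist (circle_point t) 0 = 1.
Proof.
have t_neq0 : 1 + t%:R ^+ 2 != 0 :> R by rewrite paddr_eq0 ?oner_eq0 ?exprn_ge0.
by rewrite /sqdist/= !subr0; field.
Qed.

Lemma circle_point_inj : injective circle_point.
Proof.
move=> s t [e1 e2].
have s_neq0 : 1 + s%:R ^+ 2 != 0 :> R by rewrite paddr_eq0 ?oner_eq0 ?exprn_ge0.
have t_neq0 : 1 + t%:R ^+ 2 != 0 :> R by rewrite paddr_eq0 ?oner_eq0 ?exprn_ge0.
(* t is the slope y / (1 + x) of the line through (-1, 0) and the point. *)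
have slope (r : R) : 1 + r ^+ 2 != 0 ->
    r = (r *+ 2 / (1 + r ^+ 2)) / (1 + (1 - r ^+ 2) / (1 + r ^+ 2)).
  move=> r_neq0; field; rewrite r_neq0/=.
  by rewrite [X in X != 0](_ : _ = 2) ?pnatr_eq0//; ring.
by apply/eqP; rewrite -(eqr_nat R) (slope _ s_neq0) (slope _ t_neq0) e1 e2.
Qed.

Lemma incidencesP (A C : {fset R * R}) (e : (R * R) * (R * R)) :
  reflect [/\ e.1 \in A, e.2 \in C & sqdist e.1 e.2 = 1]
    (e \in [fset e in (A `*` C)%fset | e.1 \in unit_circle e.2]%fset).
Proof.
rewrite !inE/=; apply: (iffP andP).
  by move=> [/andP[? ?] h]; split=> //; rewrite in_setE in h.
by move=> [-> -> h]; split=> //; rewrite in_setE.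
Qed.

(** A real fiber holds at most k circle points, plus one center when a point of [A] also lies in
    [C]; hence [k.+1]. All centers have imaginary part 0, hence the bound by the size of [C]. *)
Lemma typeA_construction d (A C : {fset R * R}) (k : nat) : typeA d ->
  exists Q : {fset dblnum R * dblnum R},
    [/\ (#|` Q| <= #|` A| * k + #|` C|)%N,
        (real_mult Q <= k.+1)%N,
        (0 < #|` A|)%N -> (k <= real_mult Q)%N,
        (#|` C| <= imag_mult Q)%N &
        (k * incidences A C <= num_spans Q d)%N].
Proof.
move=> [d1_gt0 d2_gt0].
pose s1 := Num.sqrt (re_coord d); pose s2 := Num.sqrt (im_coord d).
have s1E : s1 ^+ 2 = re_coord d by rewrite sqr_sqrtr// ltW.
have s2E : s2 ^+ 2 = im_coord d by rewrite sqr_sqrtr// ltW.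
have s1inj : injective (fun u : R * R => s1 *: u).
  by apply: scalerI; rewrite sqrtr_eq0 -ltNge.
have s2inj : injective (fun u : R * R => s2 *: u).
  by apply: scalerI; rewrite sqrtr_eq0 -ltNge.
pose K := [fset i in iota 0 k]%fset.
pose a_pt (e : (R * R) * nat) := dblpt (s1 *: e.1) (s2 *: circle_point e.2).
pose c_pt (c : R * R) := dblpt (s1 *: c) 0.
have a_pt_inj : injective a_pt.
  move=> [a i] [b j] /eq_dblpt/= [/s1inj -> /s2inj ij].
  by rewrite (circle_point_inj _ _ ij).
have c_pt_inj : injective c_pt by move=> a b /eq_dblpt[/s1inj].
pose Q := ((a_pt @` (A `*` K)) `|` (c_pt @` C))%fset.
have a_ptQ a i : a \in A -> i \in K -> a_pt (a, i) \in Q.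
  by move=> aA iK; rewrite in_fsetU in_imfset//= in_fsetM aA.
have c_ptQ c : c \in C -> c_pt c \in Q.
  by move=> cC; rewrite in_fsetU (in_imfset _ c_pt)// orbT.
exists Q; split.
- rewrite (leq_trans (leq_card_fsetU _ _))//.
  by rewrite !card_imfset//= cardfsM card_fset_iota.
- apply: multiplicity_le => u.
  have -> : k.+1 = (#|` K| + 1)%N by rewrite card_fset_iota addn1.
  rewrite -(cardfs1 (dblpt u 0)).
  apply: (@leq_trans
    (addn #|` [fset dblpt u (s2 *: circle_point i) | i in K]%fset|
          #|` [fset dblpt u 0]%fset|)); last by rewrite leq_add2r leq_imfset_card.
  apply: leq_trans (leq_card_fsetU _ _); apply/fsubset_leq_card/fsubsetP => q.
  rewrite !inE => /andP[+ /eqP <-].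
  move=> /orP[] /imfsetP[/= x + ->]; rewrite real_part_dblpt.
    rewrite in_fsetM => /andP[_ xK].
    by apply/orP; left; apply/imfsetP; exists x.2.
  by rewrite eqxx orbT.
- rewrite cardfs_gt0 => /fset0Pn[a aA].
  apply: leq_trans (multiplicity_ge _ Q (s1 *: a)).
  rewrite -{1}(card_fset_iota k).
  apply: (leq_card_fset_inj (fun i => a_pt (a, i))).
    by move=> i j _ _ /a_pt_inj[].
  by move=> i iK; rewrite in_fset_sep real_part_dblpt eqxx andbT a_ptQ.
- apply: leq_trans (multiplicity_ge _ Q 0).
  apply: (leq_card_fset_inj c_pt) => [c c' _ _ /c_pt_inj//|c cC].
  by rewrite in_fset_sep imag_part_dblpt eqxx andbT c_ptQ.
(* An index i < k and an incidence (a, c) determine the pair formed by the i-th point over a and the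
   center over c. *)
rewrite /incidences -{1}(card_fset_iota k) -cardfsM.
apply: (leq_card_fset_inj
  (fun x : nat * ((R * R) * (R * R)) => (a_pt (x.2.1, x.1), c_pt x.2.2))).
  move=> [i [a c]] [j [b c']] _ _ e; have /a_pt_inj[-> ->] := congr1 fst e.
  by have /c_pt_inj/= -> := congr1 snd e.
move=> [i [a c]]; rewrite in_fsetM/= => /andP[iK /incidencesP[/= aA cC ac]].
rewrite in_fset_sep in_fsetM/= a_ptQ// c_ptQ//=; apply/eqP/rho_dblpt.
  by rewrite sqdist_scale ac mulr1.
by rewrite -(scaler0 _ s2) sqdist_scale sqdist_circle_point0 mulr1.
Qed.

(** The layers have real parts (i, 0) with i < g. Two points of one layer have equal real parts, as
    a distance with first coordinate 0 demands. [A] and [C] may overlap, so a layer has at most [#|]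
    A| + #|[C|] points. *)
Lemma typeB_construction d (A C : {fset R * R}) (g : nat) : typeB d ->
  exists Q : {fset dblnum R * dblnum R},
    [/\ (#|` Q| <= g * (#|` A| + #|` C|))%N,
        (real_mult Q <= #|` A| + #|` C|)%N,
        (0 < g)%N -> (#|` A| <= real_mult Q)%N &
        (g * incidences A C <= num_spans Q d)%N].
Proof.
move=> [d1_0 d2_gt0]; pose s := Num.sqrt (im_coord d).
have sE : s ^+ 2 = im_coord d by rewrite sqr_sqrtr// ltW.
have sinj : injective (fun u : R * R => s *: u).
  by apply: scalerI; rewrite sqrtr_eq0 -ltNge.
pose G := [fset i in iota 0 g]%fset; pose S := (A `|` C)%fset.
pose pt (e : nat * (R * R)) := dblpt (e.1%:R, 0) (s *: e.2).
have pt_inj : injective pt.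
  move=> [i u] [j v] /eq_dblpt/= [[ij] /sinj ->].
  by move/eqP: ij; rewrite eqr_nat => /eqP ->.
have leS : (#|` S| <= #|` A| + #|` C|)%N by exact: leq_card_fsetU.
pose Q := (pt @` (G `*` S))%fset.
have ptQ i u : i \in G -> u \in S -> pt (i, u) \in Q.
  by move=> iG uS; rewrite in_imfset//= in_fsetM iG.
exists Q; split.
- by rewrite card_imfset//= cardfsM card_fset_iota leq_mul2l leS orbT.
- apply: multiplicity_le => u; apply: leq_trans leS.
  apply: (@leq_trans #|` [fset dblpt u (s *: v) | v in S]%fset|); last first.
    exact: leq_imfset_card.
  apply/fsubset_leq_card/fsubsetP => q; rewrite !inE => /andP[+ /eqP <-].
  move=> /imfsetP[/= x + ->]; rewrite in_fsetM real_part_dblpt => /andP[_ xS].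
  by apply/imfsetP; exists x.2.
- move=> g_gt0; apply: leq_trans (multiplicity_ge _ Q (0%:R, 0)).
  apply: (leq_card_fset_inj (fun u => pt (0%N, u))).
    by move=> u v _ _ /pt_inj[].
  move=> u uA; rewrite in_fset_sep real_part_dblpt eqxx andbT ptQ//.
    by rewrite !inE mem_iota.
  by rewrite in_fsetU uA.
rewrite /incidences -{1}(card_fset_iota g) -cardfsM.
apply: (leq_card_fset_inj
  (fun x : nat * ((R * R) * (R * R)) => (pt (x.1, x.2.1), pt (x.1, x.2.2)))).
  move=> [i [a c]] [j [b c']] _ _ e; have /pt_inj[-> ->] := congr1 fst e.
  by have /pt_inj/= [_ ->] := congr1 snd e.
move=> [i [a c]]; rewrite in_fsetM/= => /andP[iG /incidencesP[/= aA cC ac]].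
have aS : a \in S by rewrite in_fsetU aA.
have cS : c \in S by rewrite in_fsetU cC orbT.
rewrite in_fset_sep in_fsetM/= !ptQ//=; apply/eqP/rho_dblpt.
  by rewrite /sqdist/= !subrr expr0n/= addr0.
by rewrite sqdist_scale ac mulr1.
Qed.

End DoublePlane.

(** * Choice of parameters and asymptotic estimates *)

Section Sharpness.
Context {R : realType}.

(** The truncation is at least 1 and exceeds x - 1; adding the two bounds gives twice the
    truncation. *)
Lemma half_le_truncn (x : R) : 1 <= x -> x / 2 <= (Num.truncn x)%:R.
Proof.
move=> x1; have : 1 <= (Num.truncn x)%:R :> R by rewrite ler1n truncn_gt0.
by have := truncnS_gt x; rewrite -natr1; lra.
Qed.

Lemma truncn_le_ge1 (x : R) : 1 <= x -> (Num.truncn x)%:R <= x.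
Proof. by move=> x1; rewrite truncn_le (le_trans ler01). Qed.

Lemma powR_ge1 (x e : R) : 1 <= x -> 0 <= e -> 1 <= x `^ e.
Proof. by move=> x1 e0; rewrite -(powRr0 x) ler_powR. Qed.

(** Raising the exponent of c to a natural number leaves a constant independent of e. *)
Lemma powRMl_le (c x e : R) (k : nat) : 1 <= c -> 0 <= x -> e <= k%:R ->
  (c * x) `^ e <= c ^+ k * x `^ e.
Proof.
move=> c1 x0 ek; have c0 : 0 <= c by rewrite (le_trans ler01).
by rewrite powRM// ler_wpM2r ?powR_ge0// -powR_mulrn// ler_powR.
Qed.

Lemma le_powR2r (e x y : R) : 0 <= e -> 0 <= x -> x <= y -> x `^ e <= y `^ e.
Proof.
by move=> e0 x0 xy; rewrite ge0_ler_powR// nnegrE// (le_trans x0).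
Qed.

Lemma quadratic_typeA_spans (n : nat) (d : dblnum R) : (2 <= n)%N -> typeA d ->
  exists P : {fset dblnum R * dblnum R},
    #|` P| = n /\ 9^-1 * n%:R ^+ 2 <= (num_spans P d)%:R :> R.
Proof.
(* With one point in [O] and k centers the construction has at most k + k <= n points, and all k
   centers are incident to 0: at least k^2 >= n^2 / 9 pairs. *)
move=> n2 dA; pose k := n./2; have n3k : (n <= 3 * k)%N by rewrite /k; lia.
pose O : {fset R * R} := [fset 0]%fset.
pose C := (@circle_point R @` [fset i in iota 0 k])%fset.
have cardC : #|` C| = k.
  by rewrite card_imfset//= ?card_fset_iota//; exact: circle_point_inj.
have [Q [cardQ _ _ _ spanQ]] := typeA_construction d O C k dA.
have kI : (k <= incidences O C)%N.
  rewrite -{1}cardC; apply: (leq_card_fset_inj (fun c => (0, c))).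
    by move=> c c' _ _ e; exact: (congr1 snd e).
  move=> c cC; apply/incidencesP; split=> //=; first by rewrite in_fset1.
  move: cC => /imfsetP[/= i _ ->]; rewrite -(sqdist_circle_point0 i).
  by rewrite sqdistC.
have [|P [QP cardP _]] := pad_real_mult Q n.
  by apply: leq_trans cardQ _; rewrite cardfs1 cardC /k; lia.
exists P; split=> //; rewrite mulrC ler_pdivrMr//.
rewrite -natrX -natrM ler_nat.
have := leq_trans spanQ (num_spans_subset _ _ d QP).
move: (num_spans P d) => N.
have := leq_mul (leqnn k) kI; move: (incidences _ _) => I; nia.
Qed.

(** With x about n / 2, take m about x^(1 - lam) points, x centers and k about x^lam. Then k
    (m^(2/3) x^(2/3) + x) has the order x^(4/3 + lam/3) + x^(1 + lam). *)
Lemma typeA_bound_sharp (lam : R) : 0 <= lam <= 1 ->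
  unit_distance_bound_sharp R
    (fun n => Num.truncn (n%:R `^ (1 - lam) : R)) ->
  span_bound_sharp (@typeA R) (@min_mult R) lam
    (fun n => n%:R `^ (4 / 3 + lam / 3) + n%:R `^ (1 + lam)).
Proof.
move=> /andP[lam0 lam1] [c0 c0_gt0 [N0 _ sharp]].
(* 6 = 2 * 3 comes from k >= x^lam / 2 and n^lam <= 3 x^lam. The 2 comes from k + 1 <= 2 k. 36 = 2 *
   2 * 9 comes from truncating k, truncating m, and n^e <= 9 x^e for e <= 2. *)
exists 6^-1, 2, (c0 / 36); split; rewrite ?divr_gt0//.
exists (2 * N0 + 2)%N => // n /= n_big d dA.
pose n' := n./2; pose x : R := n'%:R.
have n3 : (n <= 3 * n')%N by rewrite /n'; lia.
have n2' : (n' + n' <= n)%N by rewrite /n'; lia.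
have x1 : 1 <= x by rewrite ler1n /n'; lia.
have x0 : 0 <= x by rewrite (le_trans ler01).
have xneq0 : x != 0 by rewrite gt_eqF// (lt_le_trans ltr01).
have n3x : n%:R <= 3 * x by rewrite -natrM ler_nat.
have xn : x <= n%:R by rewrite ler_nat /n'; lia.
have powR_n_le e (k : nat) : 0 <= e -> e <= k%:R ->
    n%:R `^ e <= 3 ^+ k * x `^ e.
  move=> e0 ek; apply: (@le_trans _ _ ((3 * x) `^ e)); first exact: le_powR2r.
  by apply: powRMl_le => //; rewrite ler1n.
have [|A [C [cardA cardC incAC]]] := sharp n'; first by rewrite /= /n'; lia.
pose m := Num.truncn (x `^ (1 - lam)); pose k := Num.truncn (x `^ lam).
have y1 : 1 <= x `^ lam by exact: powR_ge1.
have z1 : 1 <= x `^ (1 - lam) by apply: powR_ge1 => //; lra.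
have m_ge := half_le_truncn _ z1; have m_le := truncn_le_ge1 _ z1.
have k_ge := half_le_truncn _ y1; have k_le := truncn_le_ge1 _ y1.
rewrite -/m -/k in m_ge m_le k_ge k_le.
have k_gt0 : (0 < k)%N by rewrite truncn_gt0.
have m_gt0 : (0 < m)%N by rewrite truncn_gt0.
have yz : x `^ (1 - lam) * x `^ lam = x.
  by rewrite -powRD ?xneq0 ?implybT// subrK powRr1.
have mk_le : (m * k <= n')%N by rewrite -(ler_nat R) natrM -/x -yz ler_pM.
have kn' : (k <= n')%N.
  by rewrite (leq_trans _ mk_le)// leq_pmull.
have [Q [cardQ multQ_le multQ_ge imagQ spanQ]] := typeA_construction d A C k dA.
rewrite cardA cardC -/x -/m in cardQ multQ_ge imagQ.
have [|P [QP cardP multP]] := pad_real_mult Q n.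
  by apply: leq_trans cardQ (leq_trans _ n2'); rewrite leq_add2r.
exists P; split=> //.
  have ge_k : (k <= min_mult P)%N.
    rewrite leq_min; apply/andP; split.
      exact: leq_trans (multQ_ge m_gt0) (multiplicity_subset _ _ _ QP).
    apply: leq_trans kn' (leq_trans imagQ (multiplicity_subset _ _ _ QP)).
  (* The upper bound goes through the real multiplicity, the one that padding controls. *)
  have le_k1 : (min_mult P <= 2 * k)%N.
    rewrite geq_min; apply/orP; left; apply: leq_trans multP _.
    rewrite geq_max muln_gt0 k_gt0 mul2n -addnn (leq_trans multQ_le)//.
    by rewrite -addn1 leq_add2l.
  have ylam : n%:R `^ lam <= 3 * x `^ lam by rewrite -[3]expr1 powR_n_le.
  have xnlam : x `^ lam <= n%:R `^ lam by exact: le_powR2r.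
  move: ge_k le_k1; rewrite -!(ler_nat R) natrM; lra.
have spanP := leq_trans spanQ (num_spans_subset _ _ d QP).
rewrite -(ler_nat R) natrM in spanP; apply: le_trans spanP.
move: incAC; rewrite /unit_distance_bound -/x -/m.
move: (incidences A C)%:R => I incAC.
(* The factor 1/2 from truncation survives because 1/2 <= (1/2)^(2/3). *)
have m23 : 2^-1 * x `^ ((1 - lam) * (2 / 3)) <= m%:R `^ (2 / 3).
  apply: (@le_trans _ _ ((2^-1 * x `^ (1 - lam)) `^ (2 / 3))).
    rewrite powRM// ?powR_ge0// powRrM ler_wpM2r ?powR_ge0//.
    by apply: ger1_powR; lra.
  apply: le_powR2r; [lra| |lra].
  by rewrite mulr_ge0 ?powR_ge0.
have e1 : x `^ (4 / 3 + lam / 3) =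
    x `^ lam * (x `^ ((1 - lam) * (2 / 3)) * x `^ (2 / 3)).
  by rewrite -!powRD ?xneq0 ?implybT//; congr (_ `^ _); field.
have e2 : x `^ (1 + lam) = x `^ lam * x.
  by rewrite powRD ?xneq0 ?implybT// powRr1// mulrC.
have b1 : n%:R `^ (4 / 3 + lam / 3) <= 9 * x `^ (4 / 3 + lam / 3).
  by rewrite (_ : 9 = 3 ^+ 2) ?powR_n_le; lra.
have b2 : n%:R `^ (1 + lam) <= 9 * x `^ (1 + lam).
  by rewrite (_ : 9 = 3 ^+ 2) ?powR_n_le; lra.
have incI : c0 / 2 * (x `^ ((1 - lam) * (2 / 3)) * x `^ (2 / 3) + x) <= I.
  apply: le_trans incAC; rewrite -mulrA ler_pM2l//.
  have := ler_wpM2r (powR_ge0 x (2 / 3)) m23.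
  have : 0 <= m%:R :> R by [].
  move: x0; lra.
apply: (@le_trans _ _ (x `^ lam / 2 *
    (c0 / 2 * (x `^ ((1 - lam) * (2 / 3)) * x `^ (2 / 3) + x)))).
  rewrite [leRHS](_ : _ = c0 / 36 *
      (9 * x `^ (4 / 3 + lam / 3) + 9 * x `^ (1 + lam))).
    by rewrite ler_pM2l ?divr_gt0// lerD.
  by rewrite e1 e2; field.
apply: ler_pM => //; first by rewrite divr_ge0 ?powR_ge0.
by rewrite mulr_ge0 ?divr_ge0 ?addr_ge0 ?mulr_ge0 ?powR_ge0// ltW.
Qed.

(** With N of order n^lam points and centers and g about n / (2 N) layers, the count is at least of
    order g N^(4/3), that is n N^(1/3), or n^(1 + lam/3). *)
Lemma typeB_bound_sharp (lam : R) : 0 <= lam <= 1 ->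
  unit_distance_bound_sharp R (fun n => n) ->
  span_bound_sharp (@typeB R) (@real_mult R) lam (typeBC_bound lam).
Proof.
move=> /andP[lam0 lam1] [c0 c0_gt0 [N0 _ sharp]].
have N0_gt0 : 0 < N0.+1%:R :> R by rewrite ltr0n.
(* The first 4 is a factor 2 from truncating y^lam and a factor 2 from y = n / 2. The second
   constant reflects the layer size, at most 2 N with N <= (N0 + 1) n^lam. 16 combines n <= 4 g N
   with N^(1/3) >= n^(lam/3) / 4. *)
exists 4^-1, (2 * N0.+1%:R), (c0 / 16); split; rewrite ?divr_gt0 ?mulr_gt0//.
exists (2 * N0.+1)%N => // n /= n_big d dB.
pose y : R := n%:R / 2.
have y1 : 1 <= y.
  by rewrite ler_pdivlMr// mul1r ler_nat (leq_trans _ n_big)// leq_pmulr.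
have y0 : 0 <= y by rewrite (le_trans ler01).
have ny : n%:R = 2 * y by rewrite /y mulrC divfK.
have yl1 : 1 <= y `^ lam by exact: powR_ge1.
have nl_le : n%:R `^ lam <= 2 * y `^ lam.
  by rewrite ny -{2}[2]expr1 powRMl_le// ler1n.
have yl_le : y `^ lam <= n%:R `^ lam by apply: le_powR2r => //; rewrite ny; lra.
(* For lam = 0 the size n^lam stays below the threshold N0 of the hypothesis. *)
pose N := maxn N0.+1 (Num.truncn (y `^ lam)).
have N_gt0 : (0 < N)%N by rewrite leq_max.
have N_ge : n%:R `^ lam / 4 <= N%:R.
  apply: (@le_trans _ _ (Num.truncn (y `^ lam))%:R); last first.
    by rewrite ler_nat leq_max leqnn orbT.
  by have := half_le_truncn _ yl1; lra.
have N_le : N%:R <= N0.+1%:R * n%:R `^ lam.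
  rewrite /N; case: leqP => _.
    rewrite (le_trans (truncn_le_ge1 _ yl1))// (le_trans yl_le)//.
    by rewrite ler_peMl ?powR_ge0// ler1n.
  by apply: ler_peMr; [exact: ltW | exact: le_trans yl_le].
(* This makes room for at least one layer: the threshold on n covers N = N0 + 1, and y^lam <= y = n
   / 2 covers the other case. *)
have N2n : (2 * N <= n)%N.
  rewrite /N; case: (leqP N0.+1 (Num.truncn _)) => // _.
  rewrite -(ler_nat R) natrM ny ler_pM2l//.
  by rewrite (le_trans (truncn_le_ge1 _ yl1))// ler1_powR.
pose g := (n %/ (2 * N))%N.
have g_gt0 : (0 < g)%N by rewrite divn_gt0// muln_gt0.
have g_le : (g * (N + N) <= n)%N by rewrite addnn -mul2n leq_divM.
(* Since g >= 1, rounding down costs at most a factor 2: g + 1 <= 2 g. *)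
have n_le : (n <= 4 * (g * N))%N.
  have /ltnW/leq_trans -> // : (n < g.+1 * (2 * N))%N.
    by rewrite ltn_ceil ?muln_gt0.
  have g2 : (g.+1 <= 2 * g)%N by rewrite mul2n -addnn -addn1 leq_add2l.
  by rewrite (mulnACA 2 2 g N) leq_mul2r g2 orbT.
have [|A [C [cardA cardC incAC]]] := sharp N.
  by rewrite /= leq_max leqnSn.
have [Q [cardQ multQ_le multQ_ge spanQ]] := typeB_construction d A C g dB.
rewrite cardA cardC in cardQ multQ_le multQ_ge.
have [|P [QP cardP multP]] := pad_real_mult Q n.
  exact: leq_trans cardQ g_le.
exists P; split=> //.
  have N_leP : (N <= real_mult P)%N.
    exact: leq_trans (multQ_ge g_gt0) (multiplicity_subset _ _ _ QP).
  have P_leN : (real_mult P <= 2 * N)%N.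
    by apply: leq_trans multP _; rewrite geq_max muln_gt0 N_gt0 mul2n -addnn.
  move: N_leP P_leN; rewrite -!(ler_nat R) natrM => N_leP P_leN.
  apply/andP; split; first by rewrite (le_trans _ N_leP)// mulrC.
  by rewrite (le_trans P_leN)// -mulrA ler_pM2l.
have spanP := leq_trans spanQ (num_spans_subset _ _ d QP).
rewrite -(ler_nat R) natrM in spanP; apply: le_trans spanP.
(* For equal sizes the main term N^(2/3) N^(2/3) of the incidence bound is N * N^(1/3); the linear
   terms are dropped. *)
have incI : c0 * (N%:R * N%:R `^ (1 / 3)) <= (incidences A C)%:R.
  apply: le_trans incAC; rewrite ler_pM2l// /unit_distance_bound.
  have N_neq0 : N%:R != 0 :> R by rewrite pnatr_eq0 -lt0n.
  rewrite -powRD ?N_neq0 ?implybT//.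
  rewrite -{1}[N%:R]powRr1// -powRD ?N_neq0 ?implybT//.
  rewrite (_ : 1 + 1 / 3 = 2 / 3 + 2 / 3); last by field.
  by rewrite -addrA lerDl addr_ge0.
have n_gt0 : 0 < n%:R :> R by rewrite ny; lra.
have root_le : 4^-1 * n%:R `^ (lam / 3) <= N%:R `^ (1 / 3).
  apply: (@le_trans _ _ ((4^-1 * n%:R `^ lam) `^ (1 / 3))).
    rewrite powRM// ?powR_ge0// -powRrM mulrA mulr1.
    by rewrite ler_wpM2r ?powR_ge0// ger1_powR; lra.
  apply: le_powR2r; [lra| |lra].
  by rewrite mulr_ge0 ?powR_ge0.
have -> : typeBC_bound lam n = n%:R * n%:R `^ (lam / 3).
  rewrite /typeBC_bound powRD; first by rewrite powRr1// ltW.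
  by rewrite (gt_eqF n_gt0) implybT.
apply: (@le_trans _ _ (g%:R * (c0 * (N%:R * N%:R `^ (1 / 3))))); last first.
  by rewrite ler_wpM2l.
rewrite [leLHS](_ : _ =
  c0 * ((n%:R / 4) * (4^-1 * n%:R `^ (lam / 3)))); last by field.
rewrite [leRHS](_ : _ = c0 * ((g%:R * N%:R) * N%:R `^ (1 / 3))); last by ring.
rewrite ler_pM2l// ler_pM ?mulr_ge0 ?powR_ge0//.
by rewrite ler_pdivrMr// mulrC -!natrM ler_nat.
Qed.

End Sharpness.

Theorem claim4p1 (R : realType) :
  (* (a) *)
  (exists c1 c2 : R, [/\ 0 < c1, 0 < c2 &
     \forall n \near \oo, forall d : dblnum R, typeA d ->
       exists P : {fset dblnum R * dblnum R},
         #|` P| = n /\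
         c1 * n%:R ^+ 2 <= (num_spans P d)%:R <= c2 * n%:R ^+ 2]) /\
  (* (b) *)
  (forall lam : R, 0 <= lam <= 1 ->
     unit_distance_bound_sharp R
       (fun n => Num.truncn (n%:R `^ (1 - lam) : R)) ->
     span_bound_sharp_polylog (@typeA R) (@min_mult R) lam (typeA_bound lam)) /\
  (* (c) *)
  (unit_distance_bound_sharp R (fun n => n) ->
   forall lam : R, 0 <= lam <= 1 ->
     span_bound_sharp (@typeB R) (@real_mult R) lam (typeBC_bound lam) /\
     span_bound_sharp (@typeC R) (@imag_mult R) lam (typeBC_bound lam)).
Proof.
split; [|split].
- exists 9^-1, 1; split; rewrite ?invr_gt0//.
  apply: filterS (nbhs_infty_ge 2) => n n2 d dA.
  have [P [cardP spanP]] := quadratic_typeA_spans n d n2 dA.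
  exists P; split=> //; rewrite spanP mul1r -natrX ler_nat -cardP.
  exact: num_spans_le.
(* The exponent 2 cancels exactly the squared logarithm in [typeA_bound]; the cancellation needs ln
   n nonzero, so n >= 2. *)
- move=> lam lam01 sharp; exists 2.
  have [c1 [c2 [c [c1_gt0 c2_gt0 c_gt0 nearP]]]] :=
    typeA_bound_sharp lam lam01 sharp.
  exists c1, c2, c; split=> //; near=> n => d dA.
  rewrite /typeA_bound mulfK; last first.
    by rewrite expf_neq0// gt_eqF// ln_gt0// ltr1n; near: n;
      exact: nbhs_infty_ge.
  by move: d dA; near: n.
- move=> sharp lam lam01; have sharpB := typeB_bound_sharp lam lam01 sharp.
  by split=> //; exact: span_bound_sharp_conj.
Unshelve. all: by end_near.
Qed.
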